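(* Let $(\Sigma,\Lambda,z)$ and $(\Sigma',\Lambda',z')$ be compact discrete Riemann surfaces, let $g'$ be the genus of $\Sigma'$, and let $f:V(\Lambda)\to V(\Lambda')$ be an $N$-sheeted discrete holomorphic covering. Then the genus $g$ of $\Sigma$ is equal to $$g=N(g'-1)+1+\frac{b}{2},$$ where $b$ is the total branching number of $f$: $$b=\sum_{v\in V(\Lambda)}b_f(v)+\sum_{Q\in F(\Lambda)}b_f(Q).$$
   Context: A surface means a connected oriented surface without boundary. A bipartite quad-decomposition $\Lambda$ of a surface $\Sigma$ is a cellular decomposition of $\Sigma$ that is locally finite (a compact subset of $\Sigma$ contains only finitely many faces) and strongly regular (two different faces are either disjoint or share only one vertex or share only one edge), all of whose 2-cells are quadrilaterals and whose 1-skeleton is bipartite. $V(\Lambda)$ and $F(\Lambda)$ are the sets of vertices and faces. A decomposition of $V(\Lambda)$ into two independent sets (black and white vertices) is fixed. $Q\sim v$ means that $v$ is a vertex of the face $Q$; $V(Q)$ is the set of the four vertices of $Q$; the star of $v$ is the set of all faces incident to $v$. For $Q\in F(\Lambda)$ with vertices $b_-,w_-,b_+,w_+$ in counterclockwise order ($b_\pm$ black, $w_\pm$ white), a chart $z_Q$ of $Q$ is an orientation-preserving embedding of $Q$ onto a rectilinear quadrilateral in $\mathbb{C}$ without self-intersections such that the images of $b_-,w_-,b_+,w_+$ are its vertices. Put $\rho_Q:=-i\,\frac{z_Q(w_+)-z_Q(w_-)}{z_Q(b_+)-z_Q(b_-)}$ (with positive real part); two charts are compatible if they give the same $\rho_Q$.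 A discrete Riemann surface $(\Sigma,\Lambda,z)$ is a bipartite quad-decomposition $\Lambda$ of a surface $\Sigma$ with an atlas $z$ of compatible charts $z_Q$, $Q\in F(\Lambda)$. It is compact if $\Sigma$ is. A complex function $h$ on $V(Q)$ is discrete holomorphic if $\frac{h(b_+)-h(b_-)}{z_Q(b_+)-z_Q(b_-)}=\frac{h(w_+)-h(w_-)}{z_Q(w_+)-z_Q(w_-)}$. A mapping $f:V(\Lambda)\to V(\Lambda')$ is discrete holomorphic if (1) it maps black vertices to black vertices and white vertices to white vertices; (2) for any $Q\in F(\Lambda)$ there is $Q'\in F(\Lambda')$ with $f(v)\sim Q'$ for all $v\sim Q$; (3) for any $Q\in F(\Lambda)$ (and such $Q'$), $z'_{Q'}\circ f:V(Q)\to\mathbb{C}$ is discrete holomorphic. $f$ is biconstant at $Q$ if it takes the same value at both black vertices of $Q$ and the same value at both white vertices of $Q$. If $f$ is not biconstant at $Q$, it maps the vertices of $Q$ bijectively to the vertices of a face. For $v\in V(\Lambda)$ there is an integer $k\ge 0$ such that the image of the star of $v$ goes $k$ times along the star of $f(v)$, preserving the orientation (discarding the faces at which $f$ is biconstant, the images of the faces around $v$ in counterclockwise order run $k$ times counterclockwise through the faces around $f(v)$). The branch number of $f$ at $v$ is $b_f(v):=k-1$ (so $b_f(v)=-1$ if $k=0$). For $Q\in F(\Lambda)$, $b_f(Q):=1$ if $f$ is biconstant at $Q$ and $b_f(Q):=0$ otherwise. For a discrete holomorphic mapping $f$ there is a number $N\in\mathbb{Z}_{\ge0}\cup\{\infty\}$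 such that $N=\sum_{v\in f^{-1}(v')}(b_f(v)+1)$ for every $v'\in V(\Lambda')$. If $N>0$, $f$ is called an $N$-sheeted discrete holomorphic covering. *)

(* Defs.v *)
From HB Require Import structures.
From mathcomp Require Import all_boot all_order all_algebra.
From mathcomp Require Import classical_sets reals.
From mathcomp Require Import complex.

Set Implicit Arguments.
Unset Strict Implicit.
Unset Printing Implicit Defensive.

Import Order.TTheory GRing.Theory Num.Theory.
Local Open Scope ring_scope.

(* Cellular decompositions of compact oriented surfaces into quadrilaterals,
   as quadrilaterals glued along their sides. [corner (Q, i)], for
   i = 0, 1, 2, 3, are the vertices b_-, w_-, b_+, w_+ of Q in counterclockwise
   order, with indices in Z/4. The pair (Q, i) also stands for the side of Q
   going counterclockwise from [corner (Q, i)] to [corner (Q, i + 1)], and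
   [opp (Q, i)] is the side of the neighbouring face that is glued to it, which
   is traversed in the opposite direction. By local finiteness, the surface is
   compact exactly when there are finitely many faces. *)
Record quadGluing := QuadGluing {
  vert : finType;
  face : finType;
  black : pred vert;
  corner : face * 'Z_4 -> vert;
  opp : face * 'Z_4 -> face * 'Z_4
}.

Section QuadGluing.
Variable S : quadGluing.

(* A pair (Q, i) is also the angle of Q at [corner (Q, i)]. In the
   counterclockwise direction around that vertex, the next face lies across the
   side of Q that ends there, and the opposite of that side starts there. *)
Definition next_ccw (d : face S * 'Z_4) : face S * 'Z_4 :=
  opp (d.1, d.2 - 1).

Definition face_vertices (Q : face S) : {set vert S} :=
  [set corner (Q, i) | i : 'Z_4].

Definition adjacent (Q Q' : face S) : bool :=
  [exists i : 'Z_4, (opp (Q, i)).1 == Q'].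

(* The faces around [corner d] in counterclockwise order, from d.1 on. *)
Definition star (d : face S * 'Z_4) : seq (face S) :=
  [seq c.1 | c <- orbit next_ccw d].

End QuadGluing.

(* Bipartite quad-decompositions of compact connected oriented surfaces. The
   vertices are the classes of corners that the gluing identifies, i.e. the
   cycles of [next_ccw]. In [quad_regular], two faces that share an edge have
   exactly the two endpoints of that edge in common. *)
Record quadDecomposition := QuadDecomposition {
  gluing :> quadGluing;
  oppK : involutive (@opp gluing);
  cornerP : forall d d' : face gluing * 'Z_4,
    (corner d == corner d') = fconnect (@next_ccw gluing) d d';
  corner_surj : forall v : vert gluing, exists d, corner d = v;
  face_nonempty : (0 < #|face gluing|)%N;
  quad_connected : forall Q Q' : face gluing, connect (@adjacent gluing) Q Q';
  black_corner : forall (Q : face gluing) (i : 'Z_4),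
    black (corner (Q, i)) = ~~ odd i;
  corner_inj : forall Q : face gluing, injective (fun i => corner (Q, i));
  quad_regular : forall Q Q' : face gluing, Q != Q' ->
    let common := face_vertices Q :&: face_vertices Q' in
    [\/ common = finset.set0,
        exists v, common = [set v]
      | exists i : 'Z_4, (opp (Q, i)).1 = Q' /\
          common = [set corner (Q, i); corner (Q, i + 1)]]
}.

Section Genus.
Variable S : quadDecomposition.

(* Every edge has one black endpoint, so it is given by its unique side that
   starts at a black vertex. Edges are oriented from black to white. *)
Definition edge : finType := {d : face S * 'Z_4 | ~~ odd d.2}.

(* The cellular chain complex over the rationals, acting on row vectors. *)
Definition boundary1 : 'M[rat]_(#|edge|, #|vert S|) :=
  \matrix_(e, v)
    let d := val (enum_val e) in
    ((corner (d.1, d.2 + 1) == enum_val v)%:R - (corner d == enum_val v)%:R).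

Definition boundary2 : 'M[rat]_(#|face S|, #|edge|) :=
  \matrix_(Q, e)
    let d := val (enum_val e) in
    ((d.1 == enum_val Q)%:R - ((opp d).1 == enum_val Q)%:R).

(* First Betti number: dimension of cycles minus dimension of boundaries. *)
Definition betti1 : nat := (\rank (kermx boundary1) - \rank boundary2)%N.

(* The first homology of a closed oriented surface of genus g has rank 2g. *)
Definition genus : nat := betti1./2.

End Genus.

Section Chart.
Variable R : realType.
Local Open Scope complex_scope.

(* The polygon with vertices p 0, p 1, p 2, p 3. *)
Definition side_point (p : 'Z_4 -> R[i]) (i : 'Z_4) (t : R) : R[i] :=
  (1 - t)%:C * p i + t%:C * p (i + 1).

Definition simple_polygon (p : 'Z_4 -> R[i]) : Prop :=
  forall (i j : 'Z_4) (s t : R), 0 <= s < 1 -> 0 <= t < 1 ->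
    side_point p i s = side_point p j t -> i = j /\ s = t.

Definition twice_signed_area (p : 'Z_4 -> R[i]) : R :=
  \sum_(i : 'Z_4) complex.Im ((p i)^* * p (i + 1)).

(* The possible vertex images under an orientation-preserving embedding of a
   face onto a rectilinear quadrilateral without self-intersections. *)
Definition is_chart (p : 'Z_4 -> R[i]) : Prop :=
  simple_polygon p /\ 0 < twice_signed_area p.

End Chart.

(* [chart Q v] is relevant only when v is a vertex of Q. Charts of Q are
   compared only through rho_Q, so the atlas is given by one chart per face. *)
Record discreteRiemannSurface (R : realType) := DiscreteRiemannSurface {
  quad :> quadDecomposition;
  chart : face quad -> vert quad -> R[i];
  chartP : forall Q, is_chart (fun i => chart Q (corner (Q, i)))
}.

Section Mapping.
Variables (R : realType) (S S' : discreteRiemannSurface R).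

Definition holomorphic_on_face (Q : face S) (h : vert S -> R[i]) : Prop :=
  let b_m := corner (Q, 0) in let w_m := corner (Q, 1) in
  let b_p := corner (Q, 2) in let w_p := corner (Q, 3) in
  (h b_p - h b_m) / (chart Q b_p - chart Q b_m) =
  (h w_p - h w_m) / (chart Q w_p - chart Q w_m).

Variable f : vert S -> vert S'.

Definition maps_face (Q : face S) (Q' : face S') : bool :=
  [forall v in face_vertices Q, f v \in face_vertices Q'].

Definition discrete_holomorphic : Prop :=
  [/\ forall v, black (f v) = black v,
      forall Q, exists Q', maps_face Q Q'
    & forall Q Q', maps_face Q Q' -> holomorphic_on_face Q (chart Q' \o f)].

Definition biconstant (Q : face S) : bool :=
  (f (corner (Q, 0)) == f (corner (Q, 2))) &&
  (f (corner (Q, 1)) == f (corner (Q, 3))).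

(* The image of the star of v goes k times along the star of f v. Stars are
   cyclic sequences, whence the choice of the starting points d and d'. *)
Definition winds (v : vert S) (k : nat) : Prop :=
  exists (d : face S * 'Z_4) (d' : face S' * 'Z_4),
    [/\ corner d = v, corner d' = f v
      & all2 maps_face [seq Q <- star d | ~~ biconstant Q]
                       (flatten (nseq k (star d')))].

(* For discrete holomorphic f there is exactly one k with [winds v k]; the
   default value 0 is immaterial. *)
Definition winding (v : vert S) : nat := xget 0%N (winds v).

Definition branch_vert (v : vert S) : int := (winding v)%:Z - 1.

Definition branch_face (Q : face S) : int := (biconstant Q : nat)%:Z.

Definition total_branching : int :=
  \sum_(v : vert S) branch_vert v + \sum_(Q : face S) branch_face Q.

Definition sheeted_covering (N : nat) : Prop :=
  [/\ discrete_holomorphic, (0 < N)%N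
    & forall v' : vert S', N%:Z = \sum_(v | f v == v') (branch_vert v + 1)].

End Mapping.

(* Main.v *)
(* Both surfaces have 2g = F - V + 2: the Betti number b_1 = E - V - F + 2 with
   E = 2F comes from connectedness, and b_1 is even because V and F have the
   same parity, as one sees from the signs of the permutations of the sides
   that turn around the vertices, turn around the faces and cross the edges.
   It remains to see that exactly N F' faces are not biconstant. Each side of
   the covering surface has an image side; going once around a vertex v moves
   the image side one step around f v at each face that is not biconstant and
   leaves it unchanged at the others, so k deg(f v) corners at v are not
   biconstant, where k is the winding number. Summing over v, the number of
   corners that are not biconstant is N times the number of corners below. *)

From mathcomp Require Import all_boot all_order all_algebra fingroup perm.
From mathcomp Require Import reals complex.
From mathcomp Require classical_sets.
From mathcomp Require Import zify ring lra.
Require Import Defs.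

Set Implicit Arguments.
Unset Strict Implicit.
Unset Printing Implicit Defensive.

Import Order.TTheory GRing.Theory Num.Theory.
Local Open Scope ring_scope.

(** * Index arithmetic in Z/4, counting cycles, ranks and trajectories *)

Lemma odd_Z4D1 (i : 'Z_4) : odd (i + 1 : 'Z_4)%R = ~~ odd i.
Proof. by case: i => [[|[|[|[|]]]]]. Qed.

Lemma Z4_parity (x y : 'Z_4) : odd x = odd y -> y = x \/ y = x + 2%:R.
Proof.
move=> xy; suff: (y == x) || (y == x + 2%:R) by case/orP => /eqP; auto.
by move: x y xy => [[|[|[|[|//]]]] ?] [[|[|[|[|//]]]] ?].
Qed.

Lemma Z4_parityN (x y : 'Z_4) : odd x != odd y -> y = x + 1 \/ x = y + 1.
Proof.
move=> xy; suff: (y == x + 1) || (x == y + 1) by case/orP => /eqP; auto.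
by move: x y xy => [[|[|[|[|//]]]] ?] [[|[|[|[|//]]]] ?].
Qed.

Lemma Z4_add2_neq (i : 'Z_4) : i + 1 + 1 <> i.
Proof. by apply/eqP; case: i => [[|[|[|[|]]]]]. Qed.

Lemma Z4_sum (V : nmodType) (F : 'Z_4 -> V) :
  \sum_i F i = F 0 + F 1 + F 2%:R + F 3%:R.
Proof.
rewrite !big_ord_recl big_ord0 addr0 !addrA.
by congr (F _ + F _ + F _ + F _); apply/eqP.
Qed.

(** Serves to compute signs of permutations: cycles are counted through an invariant [h] that labels
    them. *)
Lemma card_porbits_fibers (T A : finType) (s : {perm T}) (h : T -> A) :
  (forall x y, (h x == h y) = (x \in porbit s y)) ->
  #|porbits s| = #|[set h x | x : T]|.
Proof.
move=> hP.
have -> : porbits s = [set [set y | h y == a] | a in [set h x | x : T]].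
  rewrite -imset_comp; apply: eq_imset => x; apply/setP=> y.
  by rewrite inE /= hP.
apply: card_in_imset => _ _ /imsetP[x _ ->] /imsetP[y _ ->] /setP/(_ x).
by rewrite !inE eqxx => /esym/eqP.
Qed.

(** The left kernel is the line spanned by the all-ones row, so rank-nullity applies. This is how
    connectedness enters the ranks of both boundary maps. *)
Lemma rank_row_kernel_const (F : fieldType) m n (A : 'M[F]_(n, m)) :
  (0 < n)%N ->
  (forall u : 'rV_n, u *m A = 0 <-> forall j k, u 0 j = u 0 k) ->
  (\rank A).+1 = n.
Proof.
case: n A => // n A _ kerA.
have kerE : (kermx A == (const_mx 1 : 'rV_n.+1))%MS.
  apply/andP; split.
    apply/rV_subP => u /sub_kermxP/kerA uC; apply/sub_rVP; exists (u 0 0).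
    by apply/rowP => j; rewrite !mxE mulr1.
  by apply/sub_kermxP/kerA => j k; rewrite !mxE.
have := mxrank_ker A; rewrite (eqmxP kerE) rank_rV.
have -> : (const_mx 1 : 'rV[F]_n.+1) != 0.
  by apply/eqP => /rowP/(_ 0)/eqP; rewrite !mxE oner_eq0.
have := rank_leq_row A; lia.
Qed.

Lemma sum_enum_indicator (F : nzRingType) (T : finType) (t : T)
    (u : 'I_#|T| -> F) :
  \sum_i u i * (t == enum_val i)%:R = u (enum_rank t).
Proof.
rewrite (bigD1 (enum_rank t)) //= enum_rankK eqxx mulr1 big1 ?addr0 // => i ne.
by rewrite -(can2_eq enum_valK enum_rankK) eq_sym in ne;
  rewrite (negbTE ne) mulr0.
Qed.

Lemma all2_map (A B C : Type) (r : A -> B -> bool) (a : C -> A) (b : C -> B) s :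
  all2 r (map a s) (map b s) = all (fun x => r (a x) (b x)) s.
Proof. by elim: s => //= x s ->. Qed.

(** A closed walk under [s] can only repeat the whole cycle of [y]; the number of repetitions
    becomes the winding number. *)
Lemma traject_period (T : finType) (s : T -> T) y m : iter m s y = y ->
  exists k, traject s y m = flatten (nseq k (orbit s y)).
Proof.
case: m => [|m] ym; first by exists 0%N.
have [|k kP] := @fcycle_consEflatten T s y (traject s (s y) m);
  last by exists k.+1.
by rewrite /= -[X in rcons _ X]ym iterSr -trajectSr fpath_traject.
Qed.

(** The discarded steps are those at which the image stands still, so the remaining images form an
    unbroken trajectory. Later [s] and [s'] turn around a vertex and its image, and [P] says that
    the face is not biconstant. *)
Lemma traject_lift (T T' : Type) (s : T -> T) (s' : T' -> T') (G : T -> T')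
    (P : pred T) :
  (forall x, G (s x) = if P x then s' (G x) else G x) ->
  forall n x, exists m, G (iter n s x) = iter m s' (G x) /\
    [seq G y | y <- traject s x n & P y] = traject s' (G x) m.
Proof.
move=> GP; elim=> [|n IH] x; first by exists 0%N.
have [m [itE trE]] := IH (s x); rewrite GP in itE trE.
rewrite iterSr /=; case: ifP itE trE => _ itE trE.
  by exists m.+1; rewrite iterSr /= trE.
by exists m.
Qed.

(** * Sides and the Euler characteristic *)

Section Decomposition.
Variable S : quadDecomposition.
Implicit Types (d e : face S * 'Z_4) (Q : face S) (i j : 'Z_4).

Definition side_end d := corner (d.1, d.2 + 1).

Lemma rot_inj : injective (fun d => (d.1, d.2 - 1)).
Proof.
by apply: (can_inj (g := fun d => (d.1, d.2 + 1))) => -[Q i]; rewrite /= subrK.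
Qed.

Lemma next_ccw_inj : injective (@next_ccw S).
Proof. exact: inj_comp (can_inj (@oppK S)) rot_inj. Qed.

Lemma corner_next_ccw d : corner (next_ccw d) = corner d.
Proof. by apply/esym/eqP; rewrite cornerP fconnect1. Qed.

Lemma corner_opp d : corner (opp d) = side_end d.
Proof.
rewrite /side_end -(corner_next_ccw (d.1, d.2 + 1)) /next_ccw /= addrK.
by case: d.
Qed.

Lemma side_end_opp d : side_end (opp d) = corner d.
Proof. by rewrite -corner_opp oppK. Qed.

Lemma side_end_next_ccw d : side_end (next_ccw d) = corner (d.1, d.2 - 1).
Proof. exact: side_end_opp. Qed.

Lemma black_cornerE d : black (corner d) = ~~ odd d.2.
Proof. by case: d => Q i; rewrite black_corner. Qed.

Lemma odd_opp d : odd (opp d).2 = ~~ odd d.2.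
Proof.
apply: negb_inj; rewrite -black_cornerE corner_opp black_cornerE /=.
by rewrite odd_Z4D1.
Qed.

Lemma card_even_sides :
  #|[set d : face S * 'Z_4 | ~~ odd d.2]| = (2 * #|face S|)%N.
Proof.
have -> : [set d : face S * 'Z_4 | ~~ odd d.2] =
    setX [set: face S] [set i : 'Z_4 | ~~ odd i].
  by apply/setP => d; rewrite !inE.
rewrite cardsX cardsT mulnC; congr (_ * _)%N.
by rewrite -sum1dep_card !big_mkcond /= !big_ord_recl big_ord0.
Qed.

Lemma card_edge : #|edge S| = (2 * #|face S|)%N.
Proof. by rewrite card_sig -card_even_sides cardsE. Qed.

(** The sign of a permutation of the 4F sides is the parity of its number of cycles. Turning around
    vertices (V cycles) is turning around faces (F cycles) followed by crossing edges (2F cycles),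
    and signs multiply. *)
Lemma odd_card_vert : odd #|vert S| = odd #|face S|.
Proof.
pose rot := perm rot_inj.
pose opp' := perm (can_inj (@oppK S)).
pose nxt := perm next_ccw_inj.
have nxtE : nxt = (rot * opp')%g.
  by apply/permP => d; rewrite permM !permE.
have card_nxt : #|porbits nxt| = #|vert S|.
  rewrite (@card_porbits_fibers _ _ _ (@corner S)).
    rewrite -cardsT; congr #|pred_of_set _|; apply/setP=> v; rewrite inE.
    by have [d <-] := corner_surj v; apply/imsetP; exists d.
  move=> x y; rewrite eq_sym cornerP; apply/idP/idP.
    move/iter_findex <-; apply/porbitP; eexists (findex _ _ _).
    by rewrite permX; apply: eq_iter => z; rewrite permE.
  case/porbitP=> n ->; rewrite permX.
  rewrite (_ : iter n nxt y = iter n (@next_ccw S) y) ?fconnect_iter //.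
  by apply: eq_iter => z; rewrite permE.
have card_rot : #|porbits rot| = #|face S|.
  rewrite (@card_porbits_fibers _ _ _ fst).
    rewrite -cardsT; congr #|pred_of_set _|; apply/setP=> Q; rewrite inE.
    by apply/imsetP; exists (Q, 0).
  move=> [Q i] [Q' j] /=.
  have rotX n : (rot ^+ n)%g (Q', j) = (Q', j - n%:R).
    rewrite permX; elim: n => [|n IH]; first by rewrite subr0.
    by rewrite iterS IH permE /= -natr1 opprD addrA.
  apply/eqP/porbitP => [->|[n]]; last by rewrite rotX => -[].
  by exists (j - i : 'Z_4); rewrite rotX natr_Zp subKr.
have card_opp : #|porbits opp'| = (2 * #|face S|)%N.
  (* Of the two sides of an edge, [h] picks the one that starts at a black vertex. *)
  pose h d := if odd d.2 then opp d else d.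
  rewrite (@card_porbits_fibers _ _ _ h).
    rewrite -card_even_sides; congr #|pred_of_set _|; apply/setP=> d.
    rewrite inE; apply/imsetP/idP => [[e _ ->]|/negbTE even_d].
      by rewrite /h; case: ifP => odd_e; rewrite ?odd_opp odd_e.
    by exists d; rewrite /h ?even_d.
  move=> x y; apply/eqP/porbitP => [|[n ->]].
    rewrite /h; case: ifP => _; case: ifP => _.
    - by move/(can_inj (@oppK S)) ->; exists 0%N; rewrite expg0 perm1.
    - by move=> <-; exists 1%N; rewrite expg1 permE oppK.
    - by move=> ->; exists 1%N; rewrite expg1 permE.
    - by move=> ->; exists 0%N; rewrite expg0 perm1.
  rewrite permX; elim: n => //= n <-; rewrite permE /h odd_opp.
  by case: (odd _) => /=; rewrite ?oppK.
have := odd_permM rot opp'; rewrite -nxtE /odd_perm card_nxt card_rot card_opp.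
rewrite card_prod card_ord !oddM /= andbF /=.
by rewrite addbF.
Qed.

(** * Connectedness and the cellular chain complex *)

Lemma face_const (T : Type) (u : face S -> T) :
  (forall d, u d.1 = u (opp d).1) -> forall Q Q', u Q = u Q'.
Proof.
move=> uP Q Q'; have /connectP[p] := quad_connected Q Q'.
elim: p Q => [|Q1 p IH] Q /=; first by move=> _ ->.
case/andP=> /existsP[i /eqP <-] pathp lastp.
by rewrite (uP (Q, i)); apply: IH.
Qed.

(** Following its sides, [u] is constant on each face; neighbouring faces share a vertex, so
    [face_const] finishes. *)
Lemma vert_const (T : Type) (u : vert S -> T) :
  (forall d, u (corner d) = u (side_end d)) -> forall v w, u v = u w.
Proof.
move=> uP v w.
have uQ Q i : u (corner (Q, i)) = u (corner (Q, 0)).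
  rewrite -(natr_Zp i); elim: (nat_of_ord i) => // n IH.
  by rewrite -natr1 -IH (uP (Q, n%:R)).
have [[Q i] <-] := corner_surj v; have [[Q' j] <-] := corner_surj w.
rewrite !uQ; apply: (face_const (u := fun Q => u (corner (Q, 0)))) => d.
rewrite -(uQ _ d.2) -(uQ _ (opp d).2) -!surjective_pairing corner_opp.
exact: uP.
Qed.

(** The transpose is the coboundary: its kernel consists of the functions on vertices with equal
    values at both ends of every edge. *)
Lemma rank_boundary1 : (\rank (boundary1 S)).+1 = #|vert S|.
Proof.
rewrite -mxrank_tr; apply: rank_row_kernel_const => [|u].
  have /card_gt0P[Q _] := face_nonempty S.
  by apply/card_gt0P; exists (corner (Q, 0)).
have entry (e : 'I_#|edge S|) : (u *m (boundary1 S)^T) 0 e =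
    u 0 (enum_rank (side_end (val (enum_val e)))) -
    u 0 (enum_rank (corner (val (enum_val e)))).
  rewrite mxE -!(sum_enum_indicator _ (u 0)) -sumrB; apply: eq_bigr => v _.
  by rewrite !mxE mulrBr.
split=> [u0 j k|uC]; last first.
  apply/rowP => e; rewrite entry mxE.
  by rewrite (uC _ (enum_rank (corner (val (enum_val e))))) subrr.
have even_side d : ~~ odd d.2 ->
    u 0 (enum_rank (corner d)) = u 0 (enum_rank (side_end d)).
  move=> even_d; have := entry (enum_rank (Sub d even_d : edge S)).
  by rewrite u0 mxE enum_rankK /= => /eqP; rewrite eq_sym subr_eq0 => /eqP.
rewrite -(enum_valK j) -(enum_valK k).
apply: (vert_const (u := fun v => u 0 (enum_rank v))) => d.
(* Edges are recorded by their even sides only; an odd side is treated through its opposite. *)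
case odd_d: (odd d.2); last by rewrite even_side ?odd_d.
by rewrite -(side_end_opp d) -(corner_opp d) even_side // odd_opp odd_d.
Qed.

(** A 2-cycle has equal coefficients on the two faces along each edge, so it is a multiple of the
    fundamental class. *)
Lemma rank_boundary2 : (\rank (boundary2 S)).+1 = #|face S|.
Proof.
apply: rank_row_kernel_const => [|u]; first exact: face_nonempty.
have entry (e : 'I_#|edge S|) : (u *m boundary2 S) 0 e =
    u 0 (enum_rank (val (enum_val e)).1) -
    u 0 (enum_rank (opp (val (enum_val e))).1).
  rewrite mxE -!(sum_enum_indicator _ (u 0)) -sumrB; apply: eq_bigr => v _.
  by rewrite !mxE mulrBr.
split=> [u0 j k|uC]; last first.
  apply/rowP => e; rewrite entry mxE.
  by rewrite (uC _ (enum_rank (opp (val (enum_val e))).1)) subrr.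
have even_side d : ~~ odd d.2 ->
    u 0 (enum_rank d.1) = u 0 (enum_rank (opp d).1).
  move=> even_d; have := entry (enum_rank (Sub d even_d : edge S)).
  by rewrite u0 mxE enum_rankK /= => /eqP; rewrite eq_sym subr_eq0 => /eqP.
rewrite -(enum_valK j) -(enum_valK k).
apply: (face_const (u := fun v => u 0 (enum_rank v))) => d.
case odd_d: (odd d.2); last by rewrite even_side ?odd_d.
by rewrite -[in LHS](oppK d) -even_side // odd_opp odd_d.
Qed.

(** Here [t d] is the contribution of the single side [d]. Grouped in glued pairs, the sides give
    the entry of the product; grouped by faces, they give sums that telescope around each face. *)
Lemma boundary2K : boundary2 S *m boundary1 S = 0.
Proof.
apply/matrixP => q v; rewrite !mxE.
pose t d : rat := (d.1 == enum_val q)%:R *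
  ((side_end d == enum_val v)%:R - (corner d == enum_val v)%:R).
transitivity (\sum_(d : face S * 'Z_4 | ~~ odd d.2) (t d + t (opp d))).
  transitivity (\sum_(e : edge S) (t (val e) + t (opp (val e)))); last first.
    have /card_gt0P[Q _] := face_nonempty S.
    (* Only a default for [insubd], which is applied to even sides. *)
    pose e0 : edge S := exist _ (Q, 0) isT.
    rewrite (reindex_onto val (insubd e0)) => [|d even_d];
      last by rewrite val_insubd even_d.
    by apply: eq_bigl => e; rewrite valKd eqxx andbT (valP e).
  rewrite [RHS](reindex _ (onW_bij _ (@enum_val_bij (edge S)))) /=.
  apply: eq_bigr => e _; rewrite !mxE /=.
  set d := val (enum_val e); rewrite /t corner_opp side_end_opp.
  by rewrite /side_end; ring.
transitivity (\sum_d t d).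
  rewrite big_split [RHS](bigID (fun d : face S * 'Z_4 => ~~ odd d.2)) /=.
  congr (_ + _); rewrite [RHS](reindex_inj (can_inj (@oppK S))) /=.
  by apply: eq_bigl => d; rewrite odd_opp !negbK.
transitivity (\sum_Q \sum_(i : 'Z_4) t (Q, i)).
  by rewrite pair_bigA; apply: eq_bigr => -[].
rewrite big1 // => Q _.
rewrite /t /side_end /= -mulr_sumr sumrB [X in _ - X](reindex_inj (addIr 1)) /=.
by rewrite subrr mulr0.
Qed.

(** The inclusion of boundaries in cycles makes the truncated subtraction in [betti1] exact, and the
    common parity of V and F makes its halving exact. *)
Lemma genus_euler : (2 * genus S + #|vert S|)%N = (#|face S| + 2)%N.
Proof.
have r1 := rank_boundary1; have r2 := rank_boundary2.
have le21 : (\rank (boundary2 S) <= \rank (kermx (boundary1 S)))%N.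
  by apply/mxrankS/sub_kermxP/boundary2K.
have r1_le := rank_leq_row (boundary1 S).
have cE := card_edge; have oVF := odd_card_vert.
rewrite mxrank_ker in le21.
have betti : (betti1 S + #|vert S|)%N = (#|face S| + 2)%N.
  by rewrite /betti1 mxrank_ker; lia.
have even_betti : odd (betti1 S) = false.
  have := congr1 odd betti.
  by rewrite !oddD oVF addbF addbC -[RHS]addbF => /addbI.
have := odd_double_half (betti1 S).
by rewrite even_betti -/(genus S) -muln2; lia.
Qed.

(* Strong regularity excludes multiple edges. *)
Lemma side_inj d e : corner d = corner e -> side_end d = side_end e -> d = e.
Proof.
move: d e => [Q i] [Q' j] cE eE.
have [QE|neQ] := eqVneq Q Q'.
  by rewrite -QE in cE *; rewrite (corner_inj cE).
have common_i : corner (Q, i) \in face_vertices Q :&: face_vertices Q'.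
  by rewrite inE {2}cE; apply/andP; split; exact: imset_f.
have common_i1 : corner (Q, i + 1) \in face_vertices Q :&: face_vertices Q'.
  by rewrite inE {2}[corner _]eE; apply/andP; split; exact: imset_f.
case: (quad_regular neQ) => [E|[v E]|[k [oppQ E]]].
- by rewrite E inE in common_i.
- rewrite E !inE in common_i common_i1.
  (* A single common vertex would be two consecutive corners at once, hence both black and white. *)
  have := black_cornerE (Q, i); have := black_cornerE (Q, i + 1).
  by rewrite (eqP common_i) (eqP common_i1) /= odd_Z4D1 => ->; case: (odd _).
have ik : i = k.
  rewrite E !inE in common_i common_i1.
  case/orP: common_i => /eqP /corner_inj // ik.
  case/orP: common_i1 => /eqP /corner_inj; last exact: addIr.
  by rewrite ik => /Z4_add2_neq.
(* The side glued to [(Q, i)] lies in [Q'] and runs against [(Q', j)]: it would start at index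
   [j + 1] and end at index [j]. *)
have l1 : (opp (Q, i)).2 = j + 1.
  have := corner_opp (Q, i); rewrite eE [opp _]surjective_pairing ik oppQ.
  exact: corner_inj.
have l2 : (opp (Q, i)).2 + 1 = j.
  have := side_end_opp (Q, i); rewrite cE [opp _]surjective_pairing ik oppQ.
  exact: corner_inj.
by case: (@Z4_add2_neq j); rewrite -l1 l2.
Qed.

Lemma side_between Q i j : odd i != odd j ->
  exists d, corner d = corner (Q, i) /\ side_end d = corner (Q, j).
Proof.
case/Z4_parityN => [->|->]; first by exists (Q, i).
by exists (opp (Q, j)); rewrite corner_opp side_end_opp.
Qed.

Lemma mem_orbit_next_ccw d e :
  (e \in orbit (@next_ccw S) d) = (corner e == corner d).
Proof. by rewrite -fconnect_orbit -cornerP eq_sym. Qed.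

End Decomposition.

(** * Counting corners by faces and by vertices *)

Lemma card_corners (S : quadDecomposition) (P : pred (face S)) :
  #|[set d : face S * 'Z_4 | P d.1]| = (4 * #|[set Q | P Q]|)%N.
Proof.
have -> : [set d : face S * 'Z_4 | P d.1] = setX [set Q | P Q] [set: 'Z_4].
  by apply/setP => d; rewrite !inE andbT.
by rewrite cardsX cardsT card_ord mulnC.
Qed.

Lemma card_corner_fibers (S : quadDecomposition) (P : pred (face S * 'Z_4)) :
  #|[set d | P d]| = (\sum_v #|[set d | (@corner S d == v) && P d]|)%N.
Proof.
rewrite -sum1dep_card (partition_big (@corner S) predT) //=.
apply: eq_bigr => v _; rewrite -sum1dep_card.
by apply: eq_bigl => d; rewrite andbC.
Qed.

(** * Coverings *)

Section Area.
Variable R : realType.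
Local Open Scope complex_scope.

(* The shoelace sum is the cross product of the diagonals. *)
Lemma chart_diagonals (p : 'Z_4 -> R[i]) (x : 'Z_4) : is_chart p ->
  0 < complex.Im ((p (x + 2%:R) - p x)^* * (p (x + 3%:R) - p (x + 1))).
Proof.
case=> _; suff -> : twice_signed_area p =
  complex.Im ((p (x + 2%:R) - p x)^* * (p (x + 3%:R) - p (x + 1))) by [].
rewrite /twice_signed_area (reindex_inj (addrI x)) /= Z4_sum addr0.
have -> : x + 1 + 1 = x + 2%:R by rewrite -addrA.
have -> : x + 2%:R + 1 = x + 3%:R by rewrite -addrA natr1.
have -> : x + 3%:R + 1 = x.
  by rewrite -addrA -[RHS]addr0; congr (_ + _); apply/eqP.
move: (p x) (p (x + 1)) (p (x + 2%:R)) (p (x + 3%:R)).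
move=> [a0 b0] [a1 b1] [a2 b2] [a3 b3].
by rewrite /=; ring.
Qed.

Lemma area_neq0 (a b : R[i]) : 0 < complex.Im (a^* * b) -> a != 0 /\ b != 0.
Proof.
move=> ab_gt0; split; apply/eqP => E; move: ab_gt0; rewrite E.
  by case: b {E} => bx by_ /=; lra.
by rewrite mulr0 ltxx.
Qed.

(** Multiplying both vectors by the same complex number [l] multiplies their cross product by the
    square of its modulus. *)
Lemma area_similar (a b a' b' : R[i]) : a != 0 -> b != 0 -> a' / a = b' / b ->
  0 <= complex.Im (a^* * b) -> 0 <= complex.Im (a'^* * b').
Proof.
move=> a0 b0 ab; rewrite -(divfK a0 a') -(divfK b0 b') -ab.
move: (a' / a) => l.
move: l a b {a0 b0 ab} => [lx ly] [ax ay] [bx by_] /= ab_ge0.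
rewrite [leRHS](_ : _ = (lx ^+ 2 + ly ^+ 2) * (ax * by_ + - ay * bx));
  last by ring.
by rewrite mulr_ge0 // addr_ge0 // sqr_ge0.
Qed.

End Area.

Section Covering.
Variables (R : realType) (S S' : discreteRiemannSurface R).
Variable f : vert S -> vert S'.
Hypothesis fP : discrete_holomorphic f.
Implicit Types (d e : face S * 'Z_4) (Q : face S).

Lemma maps_faceP Q (Q' : face S') : maps_face f Q Q' ->
  exists s : 'Z_4 -> 'Z_4,
    forall i, f (corner (Q, i)) = corner (Q', s i) /\ odd (s i) = odd i.
Proof.
move=> /forall_inP mQ; case: fP => fB _ _.
apply: (fin_all_exists (P := fun i j =>
  f (corner (Q, i)) = corner (Q', j) /\ odd j = odd i)) => i.
have /mQ/imsetP[j _ fE] : corner (Q, i) \in face_vertices Q by exact: imset_f.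
exists j; split => //; apply: negb_inj.
by rewrite -(black_corner Q' j) -(black_corner Q i) -fB fE.
Qed.

(* The sign of rho_Q rules out a reflection of the face. *)
Lemma maps_face_rotation Q (Q' : face S') :
  maps_face f Q Q' -> ~~ biconstant f Q ->
  exists c, forall i, f (corner (Q, i)) = corner (Q', i + c).
Proof.
move=> mQ nbQ; case: fP => _ _ /(_ _ _ mQ).
have [s sP] := maps_faceP mQ.
rewrite /holomorphic_on_face /= !(sP _).1.
pose q i := chart Q' (corner (Q', i)); pose p i := chart Q (corner (Q, i)).
rewrite -!/(q _) -/(p 0) -/(p 1) -/(p 2%:R) -/(p 3%:R) => hol.
have areaQ := chart_diagonals 0 (chartP Q).
rewrite /= !add0r -/(p 0) -/(p 1) -/(p 2%:R) -/(p 3%:R) in areaQ.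
have areaQ' x := chart_diagonals x (chartP Q').
have [p02 p13] := area_neq0 areaQ.
have q02 x : q (x + 2%:R) - q x != 0 by have [] := area_neq0 (areaQ' x).
have [s02 s13 s01] : [/\ odd (s 0) = odd (s 2%:R), odd (s 1) = odd (s 3%:R)
    & odd (s 0) != odd (s 1)] by rewrite !(sP _).2.
(* On each colour, [f] either collapses the diagonal or maps it onto a diagonal of [Q']. Collapsing
   both is biconstancy; collapsing just one contradicts holomorphy, since diagonals are nonzero. *)
have [s2E|s2E] := Z4_parity s02; have [s3E|s3E] := Z4_parity s13.
- by case/negP: nbQ; rewrite /biconstant !(sP _).1 s2E s3E !eqxx.
- move: hol; rewrite s2E s3E subrr mul0r => /esym/eqP.
  by rewrite mulf_eq0 invr_eq0 (negbTE p13) (negbTE (q02 _)).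
- move: hol; rewrite s2E s3E subrr mul0r => /eqP.
  by rewrite mulf_eq0 invr_eq0 (negbTE p02) (negbTE (q02 _)).
have [s1E|s0E] := Z4_parityN s01.
  exists (s 0) => i; rewrite (sP i).1; congr (corner (Q', _)).
  have: i \in [:: 0; 1; 2%:R; 3%:R] by case: i => [[|[|[|[|]]]]].
  rewrite !inE => /or4P[] /eqP ->; rewrite ?s3E ?s2E ?s1E ?add0r //.
  - by rewrite addrC.
  - by rewrite addrC.
  - by rewrite -addrA addrC.
(* The reflected case: the image diagonals have negative cross product, which [area_similar]
   forbids. *)
exfalso; have := area_similar p02 p13 hol (ltW areaQ).
have := areaQ' (s 1); rewrite -!/(q _) s2E s3E s0E.
have -> : s 1 + 1 + 2%:R = s 1 + 3%:R by rewrite -addrA.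
move: (q (s 1 + 3%:R) - _) (q (s 1 + 2%:R) - _) => [ax ay] [bx by_] /=; lra.
Qed.

(** Since [f] preserves colours, the ends of a side go to corners of opposite parity in one face,
    and these are joined by a side, even when the face is biconstant. *)
Lemma lift_side d : exists d' : face S' * 'Z_4,
  corner d' = f (corner d) /\ side_end d' = f (side_end d).
Proof.
case: fP => _ /(_ d.1)[Q' /maps_faceP[s sP]] _.
have [i0 odd0] := sP d.2; have [i1 odd1] := sP (d.2 + 1).
rewrite [d in corner d]surjective_pairing i0 /side_end i1.
by apply: side_between; rewrite odd0 odd1 odd_Z4D1; case: (odd _).
Qed.

Lemma winds_exists v : exists k, winds f v k.
Proof.
have [G GP] := fin_all_exists lift_side.
(* Where [f] is a rotation of the face, [G] is the rotated side. Sides are determined by their ends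
   ([side_inj]), so [G] commutes with the turn. *)
have G_rotation d : ~~ biconstant f d.1 ->
    maps_face f d.1 (G d).1 /\ G (next_ccw d) = next_ccw (G d).
  move=> nb; case: fP => _ /(_ d.1)[Q' mQ] _.
  have [c cP] := maps_face_rotation mQ nb.
  have GE : G d = (Q', d.2 + c).
    apply: side_inj; first by rewrite (GP d).1 -cP -surjective_pairing.
    by rewrite (GP d).2 /side_end cP /= addrAC.
  split; first by rewrite GE.
  apply: side_inj; first by rewrite (GP _).1 !corner_next_ccw (GP d).1.
  by rewrite (GP _).2 !side_end_next_ccw cP GE addrAC.
have G_next d : G (next_ccw d) =
    if ~~ biconstant f d.1 then next_ccw (G d) else G d.
  (* At a biconstant face, [d] and [next_ccw d] end at the opposite corners [i + 1] and [i - 1],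
     which [f] identifies, so the image side stays. *)
  case: ifPn => [/G_rotation[] //|/negPn/andP[/eqP b02 /eqP b13]].
  apply: side_inj; first by rewrite !(GP _).1 corner_next_ccw.
  rewrite !(GP _).2 side_end_next_ccw /side_end.
  case: d => Q i /= in b02 b13 *.
  have: i \in [:: 0; 1; 2%:R; 3%:R] by case: i => [[|[|[|[|]]]]].
  have [B0 B1 B2 B3] : [/\ 0 - 1 = 3%:R :> 'Z_4, 1 - 1 = 0 :> 'Z_4,
    2%:R - 1 = 1 :> 'Z_4 & 3%:R - 1 = 2%:R :> 'Z_4] by split; apply/eqP.
  have [D0 D1 D2 D3] : [/\ 0 + 1 = 1 :> 'Z_4, 1 + 1 = 2%:R :> 'Z_4,
    2%:R + 1 = 3%:R :> 'Z_4 & 3%:R + 1 = 0 :> 'Z_4] by split; apply/eqP.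
  by rewrite !inE => /or4P[] /eqP ->; rewrite ?B0 ?B1 ?B2 ?B3 ?D0 ?D1 ?D2 ?D3.
have [d dv] := corner_surj v.
(* After one full turn around [v] the image side is back at its start, so its moves make up whole
   turns around [f v]. *)
have [m [itE trE]] := traject_lift G_next (fingraph.order (@next_ccw S) d) d.
rewrite iter_order in itE; last exact: next_ccw_inj.
have [k kE] := traject_period (esym itE).
exists k, d, (G d); split; rewrite ?(GP d).1 ?dv //.
rewrite /star -map_nseq -map_flatten -kE -trE filter_map -map_comp all2_map.
by apply/allP => e; rewrite mem_filter => /andP[/G_rotation[]].
Qed.

(** Existence ensures that [xget] returns a true witness and not its default. *)
Lemma winds_winding v : winds f v (winding f v).
Proof.
have [k kP] := winds_exists v.
exact: (classical_sets.xgetPex 0%N (ex_intro _ k kP)).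
Qed.

(** Only the equal lengths of the two sequences in [winds] are needed. *)
Lemma card_star_nonbiconstant v :
  #|[set d | (corner d == v) && ~~ biconstant f d.1]| =
    (winding f v * #|[set d' | corner d' == f v]|)%N.
Proof.
have [d [d' [<- d'v]]] := winds_winding v.
rewrite all2E => /andP[/eqP + _]; rewrite /star filter_map size_map.
rewrite -map_nseq -map_flatten size_map size_flatten /shape map_nseq sumn_nseq.
move=> sizeE.
have -> : #|[set d' | corner d' == f (corner d)]| =
    size (orbit (@next_ccw S') d').
  rewrite -(card_uniqP (orbit_uniq _ _)); apply: eq_card => e.
  by rewrite mem_orbit_next_ccw inE d'v.
rewrite mulnC -sizeE -(card_uniqP (filter_uniq _ (orbit_uniq _ _))).
by apply: eq_card => e; rewrite mem_filter mem_orbit_next_ccw inE andbC.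
Qed.

End Covering.

Lemma card_nonbiconstant (R : realType) (S S' : discreteRiemannSurface R)
    (f : vert S -> vert S') N : sheeted_covering f N ->
  #|[set Q | ~~ biconstant f Q]| = (N * #|face S'|)%N.
Proof.
move=> [fP _ NP]; apply/eqP.
(* Multiplying by 4 passes from faces to corners, which are then regrouped by their vertices and by
   the images of these. *)
rewrite -(eqn_pmul2l (isT : 0 < 4)%N) -card_corners.
have -> : (4 * (N * #|face S'|) = N * #|[set d : face S' * 'Z_4 | true]|)%N.
  by rewrite (card_corners (fun=> true)) cardsT mulnCA.
rewrite !card_corner_fibers big_distrr /= (partition_big f predT) //=.
apply/eqP/eq_bigr => v' _.
have -> : N = (\sum_(v | f v == v') winding f v)%N.
  apply/eqP; rewrite -eqz_nat (NP v').
  rewrite (big_morph Posz PoszD (erefl 0%:Z)); apply/eqP.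
  by apply: eq_bigr => v _; rewrite subrK.
rewrite big_distrl; apply: eq_bigr => v /eqP <-.
rewrite card_star_nonbiconstant //; congr (_ * #|pred_of_set _|)%N.
by apply/setP => d; rewrite !inE andbT.
Qed.

Theorem theorem3p5 (R : realType) (S S' : discreteRiemannSurface R) (N : nat)
    (f : vert S -> vert S') (hf : sheeted_covering f N) :
  (genus S)%:R =
    N%:R * ((genus S')%:R - 1) + 1 + (total_branching f)%:~R / 2%:R :> rat.
Proof.
have e := genus_euler S; have e' := genus_euler S'.
have nb := card_nonbiconstant hf.
(* The biconstant faces are the complement of those counted by [nb]. *)
have biE : \sum_Q branch_face f Q = #|face S|%:Z - (N * #|face S'|)%:Z.
  rewrite -nb -(cardsC [set Q | ~~ biconstant f Q]) PoszD addrAC subrr add0r.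
  rewrite -sum1_card (big_morph Posz PoszD (erefl 0%:Z)) [RHS]big_mkcond.
  by apply: eq_bigr => Q _; rewrite !inE negbK /branch_face; case: biconstant.
(* Summing the covering condition over all [v'] counts each vertex of the covering surface once. *)
have vE : \sum_v branch_vert f v = (N * #|vert S'|)%:Z - #|vert S|%:Z.
  case: hf => _ _ NP.
  have -> : (N * #|vert S'|)%:Z = \sum_(v' : vert S') N%:Z.
    by rewrite sumr_const PoszM -mulr_natr natz.
  have -> : \sum_(v' : vert S') N%:Z = \sum_v (branch_vert f v + 1).
    by rewrite [RHS](partition_big f predT) //=; apply: eq_bigr => v' _.
  have -> : #|vert S|%:Z = \sum_(v : vert S) 1.
    by rewrite sumr_const -mulr_natr natz mul1r.
  by rewrite -sumrB; apply: eq_bigr => v _; rewrite addrK.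
rewrite /total_branching biE vE !raddfD !raddfN /= -!pmulrn !natrM.
have gE : 2%:R * (genus S)%:R + #|vert S|%:R = #|face S|%:R + 2%:R :> rat.
  by rewrite -natrM -!natrD e.
have gE' : 2%:R * (genus S')%:R + #|vert S'|%:R = #|face S'|%:R + 2%:R :> rat.
  by rewrite -natrM -!natrD e'.
have -> : (genus S)%:R =
    (#|face S|%:R + 2%:R - #|vert S|%:R) / 2%:R :> rat by lra.
have -> : (genus S')%:R =
    (#|face S'|%:R + 2%:R - #|vert S'|%:R) / 2%:R :> rat by lra.
by field.
Qed.
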